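(* For any $\mathrm{Lie}^s_{\bar{\mathcal R}}$-algebra $\mathfrak g$, with associated $\mathrm{Lie}^{s,\mathrm{ti}}_{\bar{\mathcal R}}$-algebra $\tilde{\mathfrak g}$, the homotopy groups of $\mathrm{Bar}_\bullet(\mathrm{id},\mathrm{Lie}^s_{\bar{\mathcal R}},\mathfrak g)$ and $\mathrm{Bar}_\bullet(\mathrm{id},\mathrm{Lie}^{s,\mathrm{ti}}_{\bar{\mathcal R}},\tilde{\mathfrak g})$ are isomorphic in weight less than four.
   Context: All modules are weighted graded $\mathbb F_2$-modules $\{M(w)_\bullet\}$ with weights $w\in\{1,2,3,\ldots\}$. An allowable $\bar{\mathcal R}$-module is a graded $\mathbb F_2$-module $M$ with additive operations $\bar Q^j:M_d\to M_{d+j-1}$ ($j\in\mathbb Z$), doubling weight, with $\bar Q^j(x)=0$ for $j<|x|$ and, writing $\bar Q_i(x)=\bar Q^{|x|+i}(x)$ for $i\ge0$, for all $0\le a\le b+1$: $\bar Q_a\bar Q_b=\sum_{0\le c<(a+2b-1)/3}\binom{a+b-2c-2}{b-c}\bar Q_{a+2b-2c}\bar Q_c$ (with $\binom uv=0$ unless $0\le v\le u$). A $\mathrm{Lie}^s$-algebra is a graded $\mathbb F_2$-module with a commutative bracket $L_m\otimes L_n\to L_{m+n-1}$ adding weights and satisfying the Jacobi identity; a $\mathrm{Lie}^{s,\mathrm{ti}}$-algebra is one with all self-brackets zero. A $\mathrm{Lie}^s_{\bar{\mathcal R}}$-algebra is an allowable $\bar{\mathcal R}$-module with a $\mathrm{Lie}^s$-bracket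 such that $\bar Q_0(x)=[x,x]$ and $[x,\bar Q^j(y)]=0$. A $\mathrm{Lie}^{s,\mathrm{ti}}_{\bar{\mathcal R}}$-algebra is an allowable $\bar{\mathcal R}$-module with a $\mathrm{Lie}^{s,\mathrm{ti}}$-bracket such that $\langle x,\bar Q^j(y)\rangle=0$. The same symbols denote the free-algebra monads on weighted graded $\mathbb F_2$-modules. $\mathrm{Bar}_\bullet(\mathrm{id},T,A)$ is the two-sided bar construction with $\mathrm{id}$ a right $T$-module by augmentation. Associated algebra $\tilde{\mathfrak g}$: let $V'\subset\mathfrak g$ be the ideal of self-brackets and $V=\mathfrak g/V'$ with its induced $\mathrm{Lie}^{s,\mathrm{ti}}$-bracket. Choosing a splitting of $\mathfrak g\to V$ as graded modules, $\tilde{\mathfrak g}$ is the module $\mathfrak g\cong V\times V'$ with the product $\mathrm{Lie}^{s,\mathrm{ti}}$-structure, $V'$ being given the trivial bracket, and with the same $\bar{\mathcal R}$-module structure as $\mathfrak g$. *)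

(* Defs.v *)
From HB Require Import structures.
From Stdlib Require Import PArith Lia.
From mathcomp Require Import all_boot all_order all_algebra generic_quotient.
From mathcomp Require Import boolp.
From mathcomp Require Import ring zify.

Set Implicit Arguments.
Unset Strict Implicit.
Unset Printing Implicit Defensive.

Import GRing.Theory.
Local Open Scope ring_scope.
Local Open Scope quotient_scope.

Lemma F2_cases (a : 'F_2) : a = 0 \/ a = 1.
Proof.
by case: a => m; case: m => [|[|]] // ?; [left|right]; apply: val_inj.
Qed.

Lemma addrr2 (M : lmodType 'F_2) (x : M) : x + x = 0.
Proof.
by rewrite -[x]scale1r -scalerDl (_ : 1 + 1 = 0 :> 'F_2) ?scale0r //; apply/val_inj.
Qed.

Lemma oppr2 (M : lmodType 'F_2) (x : M) : - x = x.
Proof. by apply/eqP; rewrite eq_sym -addr_eq0 addrr2. Qed.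

Lemma additive_linear (M N : lmodType 'F_2) (f : M -> N) :
  {morph f : x y / x + y} -> linear f.
Proof.
move=> fD.
have f0 : f 0 = 0 by apply: (addrI (f 0)); rewrite -fD !addr0.
move=> a x y; rewrite fD; congr (_ + _).
by case: (F2_cases a) => ->; rewrite ?scale0r ?scale1r.
Qed.

Definition linear_of_additive (M N : lmodType 'F_2) (f : M -> N)
    (fD : {morph f : x y / x + y}) : {linear M -> N} :=
  HB.pack f (GRing.isLinear.Build 'F_2 M N *:%R f (additive_linear fD)).

(* An F_2-module up to a congruence [peq]; its quotient is an honest module. *)
Record f2pre := F2Pre {
  psort :> Type;
  peq : psort -> psort -> Prop;
  pzero : psort;
  padd : psort -> psort -> psort;
  peq_refl : forall x, peq x x;
  peq_sym : forall x y, peq x y -> peq y x;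
  peq_trans : forall y x z, peq x y -> peq y z -> peq x z;
  padd_congr : forall x x' y y',
    peq x x' -> peq y y' -> peq (padd x y) (padd x' y');
  paddA : forall x y z, peq (padd x (padd y z)) (padd (padd x y) z);
  paddC : forall x y, peq (padd x y) (padd y x);
  padd0 : forall x, peq (padd pzero x) x;
  paddxx : forall x, peq (padd x x) pzero }.

Section F2Quotient.
Variable P : f2pre.

Definition peqb : rel {classic P} := fun x y => `[< peq (x : P) (y : P) >].

Lemma peqb_refl : reflexive peqb.
Proof. by move=> x; apply/asboolP/peq_refl. Qed.

Lemma peqb_sym : symmetric peqb.
Proof. by move=> x y; apply/asboolP/asboolP; apply: peq_sym. Qed.

Lemma peqb_trans : transitive peqb.
Proof.
by move=> y x z /asboolP xy /asboolP yz; apply/asboolP; apply: peq_trans xy yz.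
Qed.

Canonical peqb_equiv := EquivRel peqb peqb_refl peqb_sym peqb_trans.

Definition f2quot : Type := {eq_quot peqb}.
HB.instance Definition _ := Choice.on f2quot.

Definition to_f2quot (x : P) : f2quot := \pi_{eq_quot peqb} x.
Definition f2repr (q : f2quot) : P := repr (q : {eq_quot peqb}).

Lemma f2reprK q : to_f2quot (f2repr q) = q.
Proof. exact: reprK. Qed.

Lemma to_f2quotP x y : to_f2quot x = to_f2quot y <-> peq x y.
Proof.
split; first by move/eqP; rewrite /to_f2quot eqmodE => /asboolP.
by move=> xy; apply/eqP; rewrite /to_f2quot eqmodE; apply/asboolP.
Qed.

Lemma f2repr_to x : peq (f2repr (to_f2quot x)) x.
Proof. by apply/to_f2quotP; rewrite f2reprK. Qed.

Definition qadd (x y : f2quot) : f2quot :=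
  to_f2quot (padd (f2repr x) (f2repr y)).

Lemma to_qadd x y : to_f2quot (padd x y) = qadd (to_f2quot x) (to_f2quot y).
Proof.
by apply/to_f2quotP; apply: padd_congr; apply: peq_sym; apply: f2repr_to.
Qed.

Lemma f2quotW (Q : f2quot -> Prop) : (forall x, Q (to_f2quot x)) -> forall q, Q q.
Proof. by move=> h q; rewrite -[q]f2reprK. Qed.

Lemma qaddA : associative qadd.
Proof.
elim/f2quotW=> x; elim/f2quotW=> y; elim/f2quotW=> z.
by rewrite -!to_qadd; apply/to_f2quotP/paddA.
Qed.

Lemma qaddC : commutative qadd.
Proof.
elim/f2quotW=> x; elim/f2quotW=> y.
by rewrite -!to_qadd; apply/to_f2quotP/paddC.
Qed.

Lemma qadd0 : left_id (to_f2quot (pzero P)) qadd.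
Proof. by elim/f2quotW=> x; rewrite -!to_qadd; apply/to_f2quotP/padd0. Qed.

Lemma qaddN : left_inverse (to_f2quot (pzero P)) id qadd.
Proof. by elim/f2quotW=> x; rewrite -!to_qadd; apply/to_f2quotP/paddxx. Qed.

HB.instance Definition _ :=
  GRing.isZmodule.Build f2quot qaddA qaddC qadd0 qaddN.

Lemma to_f2quotD x y : to_f2quot (padd x y) = to_f2quot x + to_f2quot y.
Proof. exact: to_qadd. Qed.

Lemma to_f2quot0 : to_f2quot (pzero P) = 0.
Proof. by []. Qed.

Definition qscale (a : 'F_2) (x : f2quot) : f2quot := x *+ a.

Lemma f2quot_char (x : f2quot) : x + x = 0.
Proof. exact: qaddN. Qed.

Lemma f2quot_mod (x : f2quot) n : x *+ (n %% 2) = x *+ n.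
Proof.
rewrite {2}(divn_eq n 2) mulrnDr mulnC mulrnA mulr2n f2quot_char.
by rewrite mul0rn add0r.
Qed.

Lemma qscaleA a b x : qscale a (qscale b x) = qscale (a * b) x.
Proof. by rewrite /qscale -mulrnA mulnC f2quot_mod. Qed.

Lemma qscale1 : left_id 1 qscale.
Proof. by move=> x; rewrite /qscale mulr1n. Qed.

Lemma qscaleDr : right_distributive qscale +%R.
Proof. by move=> a x y; rewrite /qscale mulrnDl. Qed.

Lemma qscaleDl x : {morph qscale^~ x : a b / a + b}.
Proof. by move=> a b; rewrite /qscale f2quot_mod mulrnDr. Qed.

HB.instance Definition _ := GRing.Zmodule_isLmodule.Build 'F_2 f2quot
  qscaleA qscale1 qscaleDr qscaleDl.

End F2Quotient.

Record submod (M : lmodType 'F_2) := Submod {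
  in_submod :> M -> Prop;
  submod0 : in_submod 0;
  submodD : forall x y, in_submod x -> in_submod y -> in_submod (x + y) }.

Section Submodule.
Variables (M : lmodType 'F_2) (S : submod M).

Definition submod_pred : {pred M} := fun x => `[< S x >].

Lemma submod_pred_closed : submod_closed submod_pred.
Proof.
split; first by apply/asboolP/submod0.
move=> a x y /asboolP Sx /asboolP Sy; apply/asboolP; apply: submodD => //.
by case: (F2_cases a) => ->; rewrite ?scale0r ?scale1r //; apply: submod0.
Qed.

HB.instance Definition _ :=
  GRing.isSubmodClosed.Build 'F_2 M submod_pred submod_pred_closed.

Definition subm : Type := {x : M | x \in submod_pred}.
HB.instance Definition _ := SubChoice.on subm.
HB.instance Definition _ := [SubChoice_isSubLmodule of subm by <:].

Lemma submP (x : subm) : S (val x).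
Proof. by apply/asboolP; apply: (valP x). Qed.

Definition subm_of (x : M) (Sx : S x) : subm := Sub x (introT (asboolP _) Sx).

Program Definition quotm_pre : f2pre :=
  @F2Pre M (fun x y => S (x - y)) 0 +%R _ _ _ _ _ _ _ _.
Next Obligation. by rewrite subrr; apply: submod0. Qed.
Next Obligation. by rewrite -opprB oppr2. Qed.
Next Obligation. by rewrite -(subrKA y); apply: submodD. Qed.
Next Obligation. by rewrite opprD addrACA; apply: submodD. Qed.
Next Obligation. by rewrite addrA subrr; apply: submod0. Qed.
Next Obligation. by rewrite [X in X - _]addrC subrr; apply: submod0. Qed.
Next Obligation. by rewrite add0r subrr; apply: submod0. Qed.
Next Obligation. by rewrite addrr2 subrr; apply: submod0. Qed.

Definition quotm : lmodType 'F_2 := f2quot quotm_pre.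

Definition quotm_proj : {linear M -> quotm} :=
  linear_of_additive (@to_f2quotD quotm_pre).

End Submodule.

(* [(w, d)] : weight [w >= 1] and internal degree [d]. *)
Definition bideg : Type := (positive * int)%type.
Definition weight (b : bideg) : positive := b.1.

Notation wgmod := (bideg -> lmodType 'F_2).
Notation wghom M N := (forall b : bideg, {linear M b -> N b}).

(* The bidegrees of the two sides of a law agree only propositionally, so the
   laws compare elements by transport. *)
Definition cast (M : wgmod) (b b' : bideg) (e : b = b') (x : M b) : M b' :=
  eq_rect b (fun c => M c) x b' e.

Definition Qdeg (j : int) (b : bideg) : bideg := (b.1~0%positive, b.2 + j - 1).
Definition brdeg (a b : bideg) : bideg := ((a.1 + b.1)%positive, a.2 + b.2 - 1).

Lemma brdegC a b : brdeg a b = brdeg b a.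
Proof. by rewrite /brdeg Pos.add_comm [a.2 + _]addrC. Qed.

Lemma brdeg_rot a b c : brdeg a (brdeg b c) = brdeg b (brdeg c a).
Proof. by rewrite /brdeg /=; congr pair; [lia | ring]. Qed.

Lemma Qdeg_self b : brdeg b b = Qdeg (b.2 + 0) b.
Proof. by rewrite /brdeg /Qdeg addr0 Pos.add_diag. Qed.

Lemma Qdeg_adem (a b c : int) (d : bideg) :
  Qdeg ((Qdeg (d.2 + c) d).2 + (a + 2 * b - 2 * c)) (Qdeg (d.2 + c) d)
  = Qdeg ((Qdeg (d.2 + b) d).2 + a) (Qdeg (d.2 + b) d).
Proof. by rewrite /Qdeg /=; congr pair; ring. Qed.

(* [Qlow Q i x] is the lower-indexed operation [Q_i x = Q^(|x| + i) x]. *)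
Definition Qlow (M : wgmod) (Q : forall (j : int) (b : bideg), M b -> M (Qdeg j b))
    (i : int) (b : bideg) (x : M b) : M (Qdeg (b.2 + i) b) := Q (b.2 + i) b x.

Definition binz (u v : int) : nat :=
  if (0 <= v) && (v <= u) then 'C(`|u|%N, `|v|%N) else 0%N.

Record allowable (M : wgmod)
    (Q : forall (j : int) (b : bideg), M b -> M (Qdeg j b)) : Prop := {
  Q_additive : forall j b (x y : M b), Q j b (x + y) = Q j b x + Q j b y;
  Q_unstable : forall (j : int) b (x : M b), j < b.2 -> Q j b x = 0;
  Q_adem : forall (a b : nat) d (x : M d), (a <= b.+1)%N ->
    Qlow Q a%:Z (Qlow Q b%:Z x) =
    \sum_(0 <= c < a + 2 * b | (3 * c%:Z < a%:Z + 2 * b%:Z - 1)%R)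
       cast (Qdeg_adem a%:Z b%:Z c%:Z d)
         (Qlow Q (a%:Z + 2 * b%:Z - 2 * c%:Z) (Qlow Q c%:Z x))
       *+ binz (a%:Z + b%:Z - 2 * c%:Z - 2) (b%:Z - c%:Z) }.

Record lie_s (M : wgmod)
    (B : forall a b : bideg, M a -> M b -> M (brdeg a b)) : Prop := {
  br_addl : forall a b (x x' : M a) (y : M b),
    B _ _ (x + x') y = B _ _ x y + B _ _ x' y;
  br_addr : forall a b (x : M a) (y y' : M b),
    B _ _ x (y + y') = B _ _ x y + B _ _ x y';
  br_comm : forall a b (x : M a) (y : M b),
    B _ _ x y = cast (brdegC b a) (B _ _ y x);
  br_jacobi : forall a b c (x : M a) (y : M b) (z : M c),
    B _ _ x (B _ _ y z)
    + cast (esym (brdeg_rot a b c)) (B _ _ y (B _ _ z x))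
    + cast (brdeg_rot c a b) (B _ _ z (B _ _ x y)) = 0 }.

Record lie_s_ti (M : wgmod)
    (B : forall a b : bideg, M a -> M b -> M (brdeg a b)) : Prop := {
  lie_s_ti_lie : lie_s B;
  lie_s_ti_self : forall b (x : M b), B _ _ x x = 0 }.

Record ops (M : wgmod) := Ops {
  Qop : forall (j : int) (b : bideg), M b -> M (Qdeg j b);
  br : forall a b : bideg, M a -> M b -> M (brdeg a b) }.
Arguments Qop {M} o j {b}.
Arguments br {M} o {a b}.

Definition br_Q_zero (M : wgmod) (o : ops M) : Prop :=
  forall (j : int) a b (x : M a) (y : M b), br o x (Qop o j y) = 0.

Record lie_s_R (M : wgmod) (o : ops M) : Prop := {
  lie_s_R_allowable : allowable (@Qop M o);
  lie_s_R_lie : lie_s (@br M o);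
  lie_s_R_Q0 : forall b (x : M b),
    Qlow (@Qop M o) 0 x = cast (Qdeg_self b) (br o x x);
  lie_s_R_br_Q : br_Q_zero o }.

Record lie_s_ti_R (M : wgmod) (o : ops M) : Prop := {
  lie_s_ti_R_allowable : allowable (@Qop M o);
  lie_s_ti_R_lie : lie_s_ti (@br M o);
  lie_s_ti_R_br_Q : br_Q_zero o }.

Variant variety := LieSR | LieStiR.

Definition laws (v : variety) (M : wgmod) (o : ops M) : Prop :=
  match v with LieSR => lie_s_R o | LieStiR => lie_s_ti_R o end.

Record algebra (v : variety) := Algebra {
  carrier :> wgmod;
  opsof : ops carrier;
  lawsof : laws v opsof }.

Record is_alghom (M N : wgmod) (oM : ops M) (oN : ops N) (f : wghom M N) : Prop := {
  alghomQ : forall j b (x : M b), f _ (Qop oM j x) = Qop oN j (f _ x);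
  alghom_br : forall a b (x : M a) (y : M b),
    f _ (br oM x y) = br oN (f _ x) (f _ y) }.

(* Zero operations; the augmentation of either monad is the structure map of
   the trivial algebra. *)
Definition triv_ops (M : wgmod) : ops M := Ops (fun _ _ _ => 0) (fun _ _ _ _ => 0).

Lemma cast0 (M : wgmod) b b' (e : b = b') : cast e (0 : M b) = 0.
Proof. by case: b' / e. Qed.

Lemma cast_hom (M N : wgmod) (f : wghom M N) b b' (e : b = b') (x : M b) :
  f _ (cast e x) = cast e (f _ x).
Proof. by case: b' / e. Qed.

Lemma triv_laws v M : laws v (triv_ops M).
Proof.
have alw : allowable (@Qop M (triv_ops M)).
  split=> //=; first by move=> *; rewrite addr0.
  by move=> *; rewrite /Qlow /= big1 // => c _; rewrite cast0 mul0rn.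
have lie : lie_s (@br M (triv_ops M)) by split=> //= *; rewrite ?cast0 ?addr0.
by case: v; split=> //= *; rewrite cast0.
Qed.

Definition triv_alg v (M : wgmod) : algebra v := Algebra (triv_laws v M).

Inductive term (X : wgmod) : bideg -> Type :=
| TVar b : X b -> term X b
| TZero b : term X b
| TAdd b : term X b -> term X b -> term X b
| TQ (j : int) b : term X b -> term X (Qdeg j b)
| TBr a b : term X a -> term X b -> term X (brdeg a b).
Arguments TZero {X b}.

Fixpoint teval (X M : wgmod) (o : ops M) (f : wghom X M) (b : bideg)
    (t : term X b) : M b :=
  match t in term _ c return M c with
  | TVar _ x => f _ x
  | TZero _ => 0
  | TAdd _ s t => teval o f s + teval o f t
  | TQ j _ t => Qop o j (teval o f t)
  | TBr _ _ s t => br o (teval o f s) (teval o f t)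
  end.

(* Formal expressions in [X], identified when all linear maps from [X] to
   algebras identify them; [free_ext] and [free_ext_unique] are the resulting
   universal property. *)
Definition teq v (X : wgmod) (b : bideg) (s t : term X b) : Prop :=
  forall (A : algebra v) (f : wghom X A),
    teval (opsof A) f s = teval (opsof A) f t.

Program Definition term_pre v (X : wgmod) (b : bideg) : f2pre :=
  @F2Pre (term X b) (@teq v X b) TZero (@TAdd X b) _ _ _ _ _ _ _ _.
Next Obligation. by []. Qed.
Next Obligation. by move=> A f; rewrite H. Qed.
Next Obligation. by move=> A f; rewrite H. Qed.
Next Obligation. by move=> A f /=; rewrite H H0. Qed.
Next Obligation. by move=> A f /=; rewrite addrA. Qed.
Next Obligation. by move=> A f /=; rewrite addrC. Qed.
Next Obligation. by move=> A f /=; rewrite add0r. Qed.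
Next Obligation. by move=> A f /=; rewrite addrr2. Qed.

Definition free_mod v (X : wgmod) : wgmod := fun b => f2quot (term_pre v X b).

Section Free.
Variables (v : variety) (X : wgmod).
Local Notation F := (free_mod v X).
Local Notation cls := (@to_f2quot (term_pre v X _)).
Local Notation rep := (@f2repr (term_pre v X _)).

Definition free_ops : ops F :=
  Ops (fun j b x => cls (TQ j (rep x)) : F _)
      (fun a b x y => cls (TBr (rep x) (rep y)) : F _).

Lemma unit_additive b : {morph (fun x : X b => cls (TVar x) : F b) : x y / x + y}.
Proof.
move=> x y; rewrite -to_f2quotD; apply/to_f2quotP => A f /=; exact: linearD.
Qed.

Definition free_unit : wghom X F := fun b => linear_of_additive (@unit_additive b).

Section Ext.
Variables (A : algebra v) (f : wghom X A).

Definition ext_fun b (x : F b) : A b := teval (opsof A) f (rep x).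

Lemma ext_cls b (t : term X b) : ext_fun (cls t) = teval (opsof A) f t.
Proof. exact: (f2repr_to (t : term_pre v X b)). Qed.

Lemma ext_additive b : {morph @ext_fun b : x y / x + y}.
Proof.
elim/f2quotW=> x; elim/f2quotW=> y; rewrite -to_f2quotD.
by rewrite /= !ext_cls.
Qed.

Definition free_ext : wghom F A := fun b => linear_of_additive (@ext_additive b).

Lemma free_extE b (t : term X b) : free_ext b (cls t) = teval (opsof A) f t.
Proof. exact: ext_cls. Qed.

Lemma free_ext_hom : is_alghom free_ops (opsof A) free_ext.
Proof. by split=> *; rewrite free_extE. Qed.

Lemma free_ext_unit b x : free_ext b (free_unit b x) = f b x.
Proof. exact: free_extE. Qed.

End Ext.

Lemma free_extP b (x y : F b) :
  (forall (A : algebra v) (f : wghom X A), free_ext f b x = free_ext f b y) -> x = y.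
Proof.
move: x y; elim/f2quotW=> s; elim/f2quotW=> t h; apply/to_f2quotP => A f.
by rewrite -!free_extE; apply: h.
Qed.

Let extQ (A : algebra v) (f : wghom X A) := alghomQ (free_ext_hom f).
Let extB (A : algebra v) (f : wghom X A) := alghom_br (free_ext_hom f).

Let extQl (A : algebra v) (f : wghom X A) i b (x : F b) :
  free_ext f _ (Qlow (@Qop F free_ops) i x) = Qlow (@Qop A (opsof A)) i (free_ext f _ x).
Proof. exact: extQ. Qed.

Lemma alg_allowable (A : algebra v) : allowable (@Qop A (opsof A)).
Proof. by case: v A => -[M o []]. Qed.

Lemma alg_lie_s (A : algebra v) : lie_s (@br A (opsof A)).
Proof. by case: v A => -[M o] [] // ? []. Qed.

Lemma alg_br_Q (A : algebra v) : br_Q_zero (opsof A).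
Proof. by case: v A => -[M o []]. Qed.

Lemma free_allowable : allowable (@Qop F free_ops).
Proof.
split.
- move=> j b x y; apply: free_extP => A f.
  by rewrite extQ !linearD !extQ (Q_additive (alg_allowable A)).
- move=> j b x lt_jb; apply: free_extP => A f.
  by rewrite extQ linear0 (Q_unstable (alg_allowable A)).
- move=> a b d x le_ab; apply: free_extP => A f.
  rewrite linear_sum !extQl (Q_adem (alg_allowable A)) //.
  by apply: eq_bigr => c _; rewrite linearMn cast_hom !extQl.
Qed.

Lemma free_lie_s : lie_s (@br F free_ops).
Proof.
split=> *; apply: free_extP => A f.
- by rewrite extB !linearD !extB (br_addl (alg_lie_s A)).
- by rewrite extB !linearD !extB (br_addr (alg_lie_s A)).
- by rewrite cast_hom !extB (br_comm (alg_lie_s A)).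
- by rewrite !linearD !cast_hom !extB linear0 (br_jacobi (alg_lie_s A)).
Qed.

Lemma free_br_Q : br_Q_zero free_ops.
Proof.
by move=> *; apply: free_extP => A f; rewrite extB extQ linear0 alg_br_Q.
Qed.

End Free.

Lemma free_laws v (X : wgmod) : laws v (free_ops v X).
Proof.
have := (free_allowable v X, free_lie_s v X, @free_br_Q v X).
case: v => -[[alw lie] brQ].
  split=> // b x; apply: free_extP => A f.
  rewrite cast_hom !(alghomQ (free_ext_hom f)) (alghom_br (free_ext_hom f)).
  exact: lie_s_R_Q0 (lawsof A) _ _.
split=> //; split=> // b x; apply: free_extP => A f.
rewrite linear0 (alghom_br (free_ext_hom f)).
by case: A f => M o [? [? tiM] ?] f; apply: tiM.
Qed.

Definition free_alg v (X : wgmod) : algebra v := Algebra (free_laws v X).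

Lemma free_ext_unique v (X : wgmod) (A : algebra v) (f : wghom X A)
    (h : wghom (free_alg v X) A) :
  is_alghom (free_ops v X) (opsof A) h ->
  (forall b x, h b (free_unit v X b x) = f b x) ->
  forall b x, h b x = free_ext f b x.
Proof.
case=> hQ hB hf b; elim/f2quotW=> t; rewrite free_extE.
elim: b / t => [b x|b|b s IHs t IHt|j b t IHt|a b s IHs t IHt] /=.
- exact: hf.
- exact: linear0.
- by rewrite -IHs -IHt -linearD -to_f2quotD.
- rewrite -IHt -hQ /=; congr (h _ _); apply/to_f2quotP => B g /=.
  by rewrite (f2repr_to (t : term_pre v X _)).
- rewrite -IHs -IHt -hB /=; congr (h _ _); apply/to_f2quotP => B g /=.
  by rewrite (f2repr_to (s : term_pre v X _)) (f2repr_to (t : term_pre v X _)).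
Qed.

Lemma free_hom_eq v (X : wgmod) (A : algebra v) (h h' : wghom (free_mod v X) A) :
  is_alghom (free_ops v X) (opsof A) h -> is_alghom (free_ops v X) (opsof A) h' ->
  (forall b x, h b (free_unit v X b x) = h' b (free_unit v X b x)) ->
  forall b x, h b x = h' b x.
Proof.
move=> hh hh' hE b x.
rewrite (free_ext_unique (f := fun b => h b \o free_unit v X b) hh) //.
rewrite (free_ext_unique (f := fun b => h b \o free_unit v X b) hh') //.
by move=> b' y; rewrite /= hE.
Qed.

Lemma alghom_comp (M N P : wgmod) (oM : ops M) (oN : ops N) (oP : ops P)
    (f : wghom M N) (g : wghom N P) :
  is_alghom oM oN f -> is_alghom oN oP g ->
  is_alghom oM oP (fun b => g b \o f b).
Proof. by move=> [fQ fB] [gQ gB]; split=> * /=; rewrite ?fQ ?fB ?gQ ?gB. Qed.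

Definition free_map v (X Y : wgmod) (f : wghom X Y) :
    wghom (free_mod v X) (free_mod v Y) :=
  free_ext (A := free_alg v Y) (fun b => free_unit v Y b \o f b).

(* Structure map of an algebra; for [A := free_alg v X] it is the monad
   multiplication. *)
Definition act v (A : algebra v) : wghom (free_mod v A) A := free_ext (fun b => idfun).

Definition aug v (X : wgmod) : wghom (free_mod v X) X := act (triv_alg v X).

Section MonadLaws.
Variable v : variety.

Lemma free_map_hom (X Y : wgmod) (f : wghom X Y) :
  is_alghom (free_ops v X) (free_ops v Y) (free_map v f).
Proof. exact: (free_ext_hom (A := free_alg v Y)). Qed.

Lemma free_map_unit (X Y : wgmod) (f : wghom X Y) b x :
  free_map v f b (free_unit v X b x) = free_unit v Y b (f b x).
Proof. exact: (free_ext_unit (A := free_alg v Y)). Qed.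

Lemma act_hom (A : algebra v) : is_alghom (free_ops v A) (opsof A) (act A).
Proof. exact: free_ext_hom. Qed.

Lemma act_unit (A : algebra v) b x : act A b (free_unit v A b x) = x.
Proof. exact: free_ext_unit. Qed.

Lemma aug_hom (X : wgmod) : is_alghom (free_ops v X) (triv_ops X) (aug v X).
Proof. exact: (act_hom (triv_alg v X)). Qed.

Lemma aug_unit (X : wgmod) b x : aug v X b (free_unit v X b x) = x.
Proof. exact: (act_unit (A := triv_alg v X)). Qed.

Lemma triv_hom (X Y : wgmod) (f : wghom X Y) : is_alghom (triv_ops X) (triv_ops Y) f.
Proof. by split=> * /=; rewrite linear0. Qed.

Lemma act_natural (A B : algebra v) (f : wghom A B) :
  is_alghom (opsof A) (opsof B) f ->
  forall b x, act B b (free_map v f b x) = f b (act A b x).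
Proof.
move=> hf b x.
apply: (free_hom_eq (h := fun b => act B b \o free_map v f b)
                    (h' := fun b => f b \o act A b)) => [||b' y].
- exact: alghom_comp (free_map_hom f) (act_hom B).
- exact: alghom_comp (act_hom A) hf.
- change (act B b' (free_map v f b' (free_unit v A b' y))
          = f b' (act A b' (free_unit v A b' y))).
  by rewrite free_map_unit !act_unit.
Qed.

Lemma aug_natural (X Y : wgmod) (f : wghom X Y) b x :
  aug v Y b (free_map v f b x) = f b (aug v X b x).
Proof. exact: (act_natural (A := triv_alg v X) (B := triv_alg v Y) (triv_hom f)). Qed.

Lemma aug_act (X : wgmod) b x :
  aug v X b (act (free_alg v X) b x) = aug v X b (aug v (free_mod v X) b x).
Proof.
rewrite -(act_natural (A := free_alg v X) (B := triv_alg v X) (aug_hom X)).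
exact: aug_natural.
Qed.

Lemma free_map_comp (X Y Z : wgmod) (f : wghom X Y) (g : wghom Y Z) b x :
  free_map v g b (free_map v f b x) = free_map v (fun b => g b \o f b) b x.
Proof.
apply: (free_hom_eq (A := free_alg v Z)
  (h := fun b => free_map v g b \o free_map v f b)
  (h' := free_map v (fun b => g b \o f b))) => [||b' y].
- exact: alghom_comp (free_map_hom f) (free_map_hom g).
- exact: free_map_hom.
- change (free_map v g b' (free_map v f b' (free_unit v X b' y))
          = free_map v (fun b => g b \o f b) b' (free_unit v X b' y)).
  by rewrite !free_map_unit.
Qed.

Lemma free_map_eq (X Y : wgmod) (f g : wghom X Y) :
  (forall b x, f b x = g b x) -> forall b x, free_map v f b x = free_map v g b x.
Proof.
move=> fg b x.
apply: (free_hom_eq (A := free_alg v Y) (free_map_hom f) (free_map_hom g)).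
by move=> b' y; rewrite !free_map_unit fg.
Qed.

Lemma free_map_id (X : wgmod) (f : wghom X X) :
  (forall b x, f b x = x) -> forall b x, free_map v f b x = x.
Proof.
move=> fid b x.
apply: (free_hom_eq (A := free_alg v X) (h' := fun b => idfun)
  (free_map_hom f)) => // b' y.
by rewrite free_map_unit fid.
Qed.

End MonadLaws.

Record simplicial := Simplicial {
  sobj :> nat -> wgmod;
  face : forall n (i : nat), wghom (sobj n.+1) (sobj n);
  degen : forall n (i : nat), wghom (sobj n) (sobj n.+1);
  face_face : forall n i j b x, (i < j <= n.+2)%N ->
    face n i b (face n.+1 j b x) = face n j.-1 b (face n.+1 i b x);
  face_degen_lt : forall n i j b x, (i < j <= n.+1)%N ->
    face n.+1 i b (degen n.+1 j b x) = degen n j.-1 b (face n i b x);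
  face_degen_id : forall n i j b x, (j <= n)%N -> (i == j) || (i == j.+1) ->
    face n i b (degen n j b x) = x;
  face_degen_gt : forall n i j b x, (j.+1 < i <= n.+2)%N ->
    face n.+1 i b (degen n.+1 j b x) = degen n j b (face n i.-1 b x);
  degen_degen : forall n i j b x, (i <= j <= n)%N ->
    degen n.+1 i b (degen n j b x) = degen n.+1 j.+1 b (degen n i b x) }.

Section Homotopy.
Variable X : simplicial.

(* The kernel of [d_0, ..., d_(n-1)] in degree [n]; the differential of this
   normalized complex is [d_n]. *)
Definition normalized n (b : bideg) (x : X n b) : Prop :=
  match n return X n b -> Prop with
  | 0%N => fun _ => True
  | m.+1 => fun x => forall i, (i <= m)%N -> face X m i b x = 0
  end x.

Definition ncycle n (b : bideg) (x : X n b) : Prop :=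
  match n return X n b -> Prop with
  | 0%N => fun _ => True
  | m.+1 => fun x => normalized x /\ face X m m.+1 b x = 0
  end x.

Definition nboundary n (b : bideg) (x : X n b) : Prop :=
  exists2 z : X n.+1 b, normalized z & face X n n.+1 b z = x.

Program Definition ncycles n b : submod (X n b) := Submod (in_submod := @ncycle n b) _ _.
Next Obligation. by case: n => //= m; split=> [i _|]; apply: linear0. Qed.
Next Obligation.
case: n x y H H0 => //= m x y [nx cx] [ny cy].
by split=> [i le_im|]; rewrite linearD /= ?cx ?cy ?nx ?ny ?addr0.
Qed.

Program Definition nboundaries n b : submod (subm (ncycles n b)) :=
  Submod (in_submod := fun x => nboundary (val x)) _ _.
Next Obligation. by exists 0 => [i _|]; apply: linear0. Qed.
Next Obligation.
case: H H0 => [z nz zx] [t nt ty]; exists (z + t); last by rewrite linearD /= zx ty.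
by move=> i le_in; rewrite linearD /= nz ?nt ?addr0.
Qed.

Definition homotopy_group (n : nat) : wgmod := fun b => quotm (nboundaries n b).

End Homotopy.

Section Bar.
Variables (v : variety) (A : algebra v).

Fixpoint bar_alg (n : nat) : algebra v :=
  if n is m.+1 then free_alg v (bar_alg m) else A.

Definition bar_obj (n : nat) : wgmod := bar_alg n.

(* [bar_inner n i] is [T^i] of the structure map of [T^(n-i) A], and
   [bar_degen n i] is [T^i] of the unit of [T^(n-i) A], for [i <= n]; the zero
   maps are junk values outside this range. *)
Fixpoint bar_inner (n i : nat) : wghom (bar_obj n.+1) (bar_obj n) :=
  match i, n return wghom (bar_obj n.+1) (bar_obj n) with
  | 0%N, n => act (bar_alg n)
  | i.+1, 0%N => fun b => \0
  | i.+1, m.+1 => free_map v (bar_inner m i)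
  end.

Definition bar_face (n i : nat) : wghom (bar_obj n.+1) (bar_obj n) :=
  if i is i'.+1 then bar_inner n i' else aug v (bar_obj n).

Fixpoint bar_degen (n i : nat) : wghom (bar_obj n) (bar_obj n.+1) :=
  match i, n return wghom (bar_obj n) (bar_obj n.+1) with
  | 0%N, n => free_unit v (bar_obj n)
  | i.+1, 0%N => fun b => \0
  | i.+1, m.+1 => free_map v (bar_degen m i)
  end.

Lemma bar_inner_hom n i : (i <= n)%N ->
  is_alghom (opsof (bar_alg n.+1)) (opsof (bar_alg n)) (bar_inner n i).
Proof.
case: i n => [|i] [|n] //= _;
  [exact: act_hom | exact: (act_hom (bar_alg n.+1)) | exact: free_map_hom].
Qed.

Lemma bar_inner0 n : bar_inner n 0 = act (bar_alg n).
Proof. by case: n. Qed.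

Lemma bar_degen0 n : bar_degen n 0 = free_unit v (bar_obj n).
Proof. by case: n. Qed.

Lemma bar_inner_natural n i j b x : (j <= n)%N -> i = 0%N ->
  bar_inner n i b (free_map v (bar_inner n j) b x)
  = bar_inner n j b (act (bar_alg n.+1) b x).
Proof.
by move=> le_jn ->; rewrite bar_inner0; apply: act_natural; apply: bar_inner_hom.
Qed.

Lemma bar_inner_inner n i j b x : (i < j <= n.+1)%N ->
  bar_inner n i b (bar_inner n.+1 j b x) = bar_inner n j.-1 b (bar_inner n.+1 i b x).
Proof.
elim: n i j b x => [|n IHn] [|i] [|j] b x // /andP[lt_ij le_jn].
- exact: bar_inner_natural.
- by case: j lt_ij le_jn.
- exact: bar_inner_natural.
- case: j lt_ij le_jn => // j lt_ij le_jn.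
  change (free_map v (bar_inner n i) b (free_map v (bar_inner n.+1 j.+1) b x)
    = free_map v (bar_inner n j) b (free_map v (bar_inner n.+1 i) b x)).
  rewrite !free_map_comp; apply: free_map_eq => c y; apply: IHn; lia.
Qed.

Lemma bar_face_face n i j b x : (i < j <= n.+2)%N ->
  bar_face n i b (bar_face n.+1 j b x) = bar_face n j.-1 b (bar_face n.+1 i b x).
Proof.
case: i j => [|i] [|j] // /andP[lt_ij le_jn]; last first.
  case: j lt_ij le_jn => // j lt_ij le_jn.
  by apply: bar_inner_inner; lia.
case: j lt_ij le_jn => [|j] _ _; first exact: aug_act.
exact: aug_natural.
Qed.

Lemma bar_inner_degen_lt n i j b x : (i.+1 < j <= n.+1)%N ->
  bar_inner n.+1 i b (bar_degen n.+1 j b x) = bar_degen n j.-1 b (bar_inner n i b x).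
Proof.
elim: n i j b x => [|n IHn] i j b x /andP[lt_ij le_jn]; first by exfalso; lia.
case: i j lt_ij le_jn => [|i] [|[|j]] // lt_ij le_jn.
  change (act (bar_alg n.+2) b (free_map v (bar_degen n.+1 j.+1) b x)
    = free_map v (bar_degen n j) b (act (bar_alg n.+1) b x)).
  apply: (act_natural (A := bar_alg n.+1) (B := bar_alg n.+2)).
  exact: free_map_hom.
change (free_map v (bar_inner n.+1 i) b (free_map v (bar_degen n.+1 j.+1) b x)
  = free_map v (bar_degen n j) b (free_map v (bar_inner n i) b x)).
by rewrite !free_map_comp; apply: free_map_eq => c y; apply: IHn; lia.
Qed.

Lemma bar_face_degen_lt n i j b x : (i < j <= n.+1)%N ->
  bar_face n.+1 i b (bar_degen n.+1 j b x) = bar_degen n j.-1 b (bar_face n i b x).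
Proof.
case: i j => [|i] [|j] // lt_ij; first exact: aug_natural.
exact: bar_inner_degen_lt.
Qed.

Lemma bar_inner_degen_id n i j b x : (j <= n)%N -> (i.+1 == j) || (i == j) ->
  bar_inner n i b (bar_degen n j b x) = x.
Proof.
elim: n i j b x => [|n IHn] [|i] [|j] b x // le_jn ij.
- exact: act_unit.
- exact: act_unit.
- case: j le_jn ij => // le_jn _.
  change (act (bar_alg n.+1) b (free_map v (bar_degen n 0) b x) = x).
  rewrite bar_degen0 /act.
  apply: (free_hom_eq (A := free_alg v (bar_obj n))
    (h := fun b => act (bar_alg n.+1) b \o free_map v (free_unit v (bar_obj n)) b)
    (h' := fun b => idfun)).
  + exact: alghom_comp (free_map_hom _ _) (act_hom _).
  + by [].
  + move=> c y.
    change (act (bar_alg n.+1) c (free_map v (free_unit v (bar_obj n)) c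
      (free_unit v (bar_obj n) c y)) = free_unit v (bar_obj n) c y).
    by rewrite free_map_unit act_unit.
- change (free_map v (bar_inner n i) b (free_map v (bar_degen n j) b x) = x).
  by rewrite free_map_comp; apply: free_map_id => c y; apply: IHn.
Qed.

Lemma bar_face_degen_id n i j b x : (j <= n)%N -> (i == j) || (i == j.+1) ->
  bar_face n i b (bar_degen n j b x) = x.
Proof.
case: i => [|i] le_jn ij; last exact: bar_inner_degen_id.
case: j le_jn ij => // _ _; rewrite bar_degen0; exact: aug_unit.
Qed.

Lemma bar_inner_degen_gt n i j b x : (j < i <= n.+1)%N ->
  bar_inner n.+1 i b (bar_degen n.+1 j b x) = bar_degen n j b (bar_inner n i.-1 b x).
Proof.
elim: n i j b x => [|n IHn] [|i] [|j] b x // /andP[lt_ji le_in].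
- change (free_map v (bar_inner 0 i) b (free_unit v (bar_obj 1) b x)
    = free_unit v (bar_obj 0) b (bar_inner 0 i b x)).
  exact: free_map_unit.
- by case: i lt_ji le_in.
- change (free_map v (bar_inner n.+1 i) b (free_unit v (bar_obj n.+2) b x)
    = free_unit v (bar_obj n.+1) b (bar_inner n.+1 i b x)).
  exact: free_map_unit.
- case: i lt_ji le_in => // i lt_ji le_in.
  change (free_map v (bar_inner n.+1 i.+1) b (free_map v (bar_degen n.+1 j) b x)
    = free_map v (bar_degen n j) b (free_map v (bar_inner n i) b x)).
  by rewrite !free_map_comp; apply: free_map_eq => c y; apply: IHn; lia.
Qed.

Lemma bar_face_degen_gt n i j b x : (j.+1 < i <= n.+2)%N ->
  bar_face n.+1 i b (bar_degen n.+1 j b x) = bar_degen n j b (bar_face n i.-1 b x).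
Proof. by case: i => [|[|i]] // lt_ji; apply: bar_inner_degen_gt. Qed.

Lemma bar_degen_degen n i j b x : (i <= j <= n)%N ->
  bar_degen n.+1 i b (bar_degen n j b x) = bar_degen n.+1 j.+1 b (bar_degen n i b x).
Proof.
elim: n i j b x => [|n IHn] i j b x /andP[le_ij le_jn].
  have [-> ->] : i = 0%N /\ j = 0%N by lia.
  by apply: esym; exact: (@free_map_unit v (bar_obj 0) (bar_obj 1) (bar_degen 0 0)).
case: i j le_ij le_jn => [|i] [|j] // le_ij le_jn.
- apply: esym.
  exact: (@free_map_unit v (bar_obj n.+1) (bar_obj n.+2) (bar_degen n.+1 0)).
- apply: esym.
  exact: (@free_map_unit v (bar_obj n.+1) (bar_obj n.+2) (bar_degen n.+1 j.+1)).
- change (free_map v (bar_degen n.+1 i) b (free_map v (bar_degen n j) b x)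
    = free_map v (bar_degen n.+1 j.+1) b (free_map v (bar_degen n i) b x)).
  by rewrite !free_map_comp; apply: free_map_eq => c y; apply: IHn; lia.
Qed.

Definition Bar : simplicial := Simplicial bar_face_face bar_face_degen_lt
  bar_face_degen_id bar_face_degen_gt bar_degen_degen.

End Bar.

Section Associated.
Variable g : algebra LieSR.
Local Notation B := (br (opsof g)).

Let lieB : lie_s (@br g (opsof g)) := lie_s_R_lie (lawsof g).

(* The Lie ideal generated by the self-brackets; by the Jacobi identity it
   consists of self-brackets only. *)
Inductive self_ideal : forall b : bideg, g b -> Prop :=
| SelfBr b (x : g b) : self_ideal (B x x)
| SelfZero b : self_ideal (0 : g b)
| SelfAdd b (x y : g b) : self_ideal x -> self_ideal y -> self_ideal (x + y)
| SelfIdeal a b (x : g a) (y : g b) : self_ideal y -> self_ideal (B x y).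

Definition self_submod b : submod (g b) :=
  Submod (@SelfZero b) (@SelfAdd b).

Definition V' : wgmod := fun b => subm (self_submod b).
Definition V : wgmod := fun b => quotm (self_submod b).
Definition projV : wghom g V := fun b => quotm_proj (self_submod b).

Lemma projV_eq b (x y : g b) : projV b x = projV b y <-> self_ideal (x - y).
Proof. exact: to_f2quotP. Qed.

Lemma projV_eq0 b (x : g b) : projV b x = 0 <-> self_ideal x.
Proof. by rewrite -(linear0 (projV b)) projV_eq subr0. Qed.

Definition liftV b (v : V b) : g b := f2repr v.

Lemma liftVK b (v : V b) : projV b (liftV v) = v.
Proof. exact: f2reprK. Qed.

Definition brV a b (v : V a) (w : V b) : V (brdeg a b) :=
  projV _ (B (liftV v) (liftV w)).

Lemma self_ideal_cast b b' (e : b = b') (x : g b) :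
  self_ideal x -> self_ideal (cast e x).
Proof. by case: b' / e. Qed.

Lemma brV_proj a b (x : g a) (y : g b) :
  brV (projV a x) (projV b y) = projV _ (B x y).
Proof.
have hx : self_ideal (liftV (projV a x) - x) by apply/projV_eq; rewrite liftVK.
have hy : self_ideal (liftV (projV b y) - y) by apply/projV_eq; rewrite liftVK.
rewrite /brV -[liftV (projV a x)](subrK x) -[liftV (projV b y)](subrK y).
move: (liftV _ - x) (liftV _ - y) hx hy => x' y' hx hy.
rewrite (br_addl lieB) !(br_addr lieB) 3!linearD.
have r0 c d (s : g c) (t : g d) : self_ideal t -> projV _ (B s t) = 0.
  by move=> st; apply/projV_eq0; apply: SelfIdeal.
have l0 : projV _ (B x' y) = 0.
  rewrite (br_comm lieB); apply/projV_eq0/self_ideal_cast; exact: SelfIdeal.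
by rewrite l0 (r0 _ _ x' y' hy) (r0 _ _ x y' hy) !add0r.
Qed.

Lemma projVW b (P : V b -> Prop) : (forall x, P (projV b x)) -> forall v, P v.
Proof. by move=> h v; rewrite -(liftVK v). Qed.

Lemma brV_lie_s_ti : lie_s_ti brV.
Proof.
split; first split.
- move=> a b; elim/projVW=> x; elim/projVW=> x'; elim/projVW=> y.
  by rewrite -linearD !brV_proj (br_addl lieB) linearD.
- move=> a b; elim/projVW=> x; elim/projVW=> y; elim/projVW=> y'.
  by rewrite -linearD !brV_proj (br_addr lieB) linearD.
- move=> a b; elim/projVW=> x; elim/projVW=> y.
  by rewrite !brV_proj (br_comm lieB) cast_hom.
- move=> a b c; elim/projVW=> x; elim/projVW=> y; elim/projVW=> z.
  by rewrite !brV_proj -!cast_hom -!linearD (br_jacobi lieB) linear0.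
- move=> b; elim/projVW=> x; rewrite brV_proj; apply/projV_eq0; exact: SelfBr.
Qed.

Definition VxV' : wgmod := fun b => (V b * V' b)%type.

Definition brVxV' a b (x : VxV' a) (y : VxV' b) : VxV' (brdeg a b) :=
  (brV x.1 y.1, 0).

Record splitting := Splitting {
  sec : wghom V g;
  secK : forall b v, projV b (sec b v) = v }.

Variable s : splitting.

Lemma split_ker b (x : g b) : self_ideal (x - sec s b (projV b x)).
Proof. by apply/projV_eq; rewrite secK. Qed.

Definition to_VxV'_fun b (x : g b) : VxV' b :=
  (projV b x, subm_of (S := self_submod b) (split_ker x)).

Lemma to_VxV'_additive b : {morph @to_VxV'_fun b : x y / x + y}.
Proof.
move=> x y; congr (_, _); first exact: linearD.
apply: val_inj.
change (x + y - sec s b (projV b (x + y))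
  = (x - sec s b (projV b x)) + (y - sec s b (projV b y))).
by rewrite 2!linearD opprD addrACA.
Qed.

Definition to_VxV' : wghom g VxV' := fun b => linear_of_additive (@to_VxV'_additive b).

Definition of_VxV'_fun b (p : VxV' b) : g b := sec s b p.1 + val p.2.

Lemma of_VxV'_additive b : {morph @of_VxV'_fun b : x y / x + y}.
Proof. by move=> x y; rewrite /of_VxV'_fun linearD addrACA. Qed.

Definition of_VxV' : wghom VxV' g := fun b => linear_of_additive (@of_VxV'_additive b).

Lemma to_VxV'K b (x : g b) : of_VxV' b (to_VxV' b x) = x.
Proof. by rewrite /= /of_VxV'_fun /= addrC subrK. Qed.

Lemma of_VxV'K b (p : VxV' b) : to_VxV' b (of_VxV' b p) = p.
Proof.
case: p => v w.
have projE : projV b (sec s b v + val w) = v.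
  rewrite linearD secK (_ : projV b (val w) = 0) ?addr0 //.
  by apply/projV_eq0; exact: (submP w).
congr (_, _); first exact: projE.
apply: val_inj.
change (sec s b v + val w - sec s b (projV b (sec s b v + val w)) = val w).
by rewrite projE addrAC subrr add0r.
Qed.

(* The product bracket of [V x V'] (trivial on [V']) carried over to [g] by the
   isomorphism that the splitting determines. *)
Definition br_tilde a b (x : g a) (y : g b) : g (brdeg a b) :=
  of_VxV' _ (brVxV' (to_VxV' a x) (to_VxV' b y)).

Definition ops_tilde : ops g := Ops (@Qop g (opsof g)) br_tilde.

Lemma brVxV'_lie_s_ti : lie_s_ti brVxV'.
Proof.
have [[dl dr cm jc] sf] := brV_lie_s_ti.
have castp b b' (e : b = b') (p : VxV' b) : cast e p = (cast e p.1, cast e p.2).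
  by case: b' / e; case: p.
have eqp b (p q : VxV' b) : p.1 = q.1 -> p.2 = q.2 -> p = q.
  by case: p q => [? ?] [? ?] /= -> ->.
split; first split.
- by move=> a b x x' y; apply: eqp; [exact: dl | exact/esym/addr0].
- by move=> a b x y y'; apply: eqp; [exact: dr | exact/esym/addr0].
- by move=> a b x y; apply: eqp; rewrite castp; [exact: cm | exact/esym/cast0].
- move=> a b c x y z; rewrite !castp; apply: eqp; first exact: jc.
  change (0 + cast (esym (brdeg_rot a b c)) 0 + cast (brdeg_rot c a b) 0 = 0
    :> V' _).
  by rewrite !cast0 !addr0.
- by move=> b x; apply: eqp; [exact: sf | ].
Qed.

Lemma br_tilde_lie_s_ti : lie_s_ti br_tilde.
Proof.
have [[dl dr cm jc] sf] := brVxV'_lie_s_ti.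
rewrite /br_tilde; split; first split.
- by move=> *; rewrite linearD dl linearD.
- by move=> *; rewrite linearD dr linearD.
- by move=> *; rewrite cm cast_hom.
- by move=> *; rewrite -!cast_hom -!linearD !of_VxV'K jc linear0.
- by move=> *; rewrite sf linear0.
Qed.

Lemma tilde_laws : laws LieStiR ops_tilde.
Proof.
split.
- exact: lie_s_R_allowable (lawsof g).
- exact: br_tilde_lie_s_ti.
- move=> j a b x y; rewrite /= /br_tilde /brVxV' /=.
  by rewrite brV_proj (lie_s_R_br_Q (lawsof g)) linear0 -(linear0 (of_VxV' _)).
Qed.

Definition assoc_alg : algebra LieStiR := Algebra tilde_laws.

End Associated.

Definition isomorphic (M N : lmodType 'F_2) : Prop :=
  exists f : {linear M -> N}, bijective f.

(* Main.v *)
(** Below weight four the only operations are the [Q^j] on weight one and brackets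
    of total weight two and three, and brackets annihilate the [Q^j x]. Hence if [c]
    is a symmetric bilinear form on the weight-one part with [c(x, x) = x], adding
    [Q_0 c(x, y)] to the bracket of weight-one elements exchanges the two kinds of
    algebra, [Q_0 x = [x, x]] becoming [[x, x] = 0] and conversely. Free algebras
    agree with their generators in weight one, so such a form propagates to every
    level of the bar construction, where twisting the bracket identifies the two
    simplicial modules. On [g] the form is chosen so that [Q_0 c(x, y)] is the
    [V']-component of [[x, y]]; twisting by it agrees, below weight four, with
    passing to the associated algebra. *)

Require Import Defs.
From Stdlib Require Import PArith.
From mathcomp Require Import all_boot all_order all_algebra.
From mathcomp Require Import boolp classical_sets functions zify.

Set Implicit Arguments.
Unset Strict Implicit.
Unset Printing Implicit Defensive.

Import GRing.Theory.
Local Open Scope ring_scope.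

(** * Complements, generalized inverses and idempotent products over [F_2] *)

Section LinearAlgebra.
Implicit Types M N : lmodType 'F_2.

(** Zorn's lemma on the subsets closed under addition that meet [S] at most in zero. Containing 0 is
    left out of [P] so that the union of the empty chain, the empty set, qualifies; maximality then
    supplies 0. *)
Lemma complement_exists M (S : submod M) :
  exists2 C : submod M, (forall x, S x -> C x -> x = 0) &
    forall x, exists2 y, S y & C (x - y).
Proof.
pose P (A : set M) := (forall x y, A x -> A y -> A (x + y)) /\
  (forall x, S x -> A x -> x = 0).
have [|A [[Aadd A0] Amax]] := @Zorn_bigcup M P.
  move=> F FP totF; split=> [x y [X FX Xx] [Y FY Yy]|x Sx [X FX Xx]]; last first.
    by have [_] := FP X FX; apply.
  have [XY|YX] := totF X Y FX FY.
    by exists Y => //; have [YD _] := FP Y FY; apply: YD => //; apply: XY.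
  by exists X => //; have [XD _] := FP X FX; apply: XD => //; apply: YX.
have Aext (B : set M) : (forall x, A x -> B x) -> P B -> forall x, B x -> A x.
  move=> AB PB x Bx; apply: contrapT => nAx; apply: (Amax B) => //.
  by split=> [//|BA]; apply/nAx/BA.
have Az : A 0.
  apply: (Aext (fun x => A x \/ x = 0)); [by left | | by right].
  split=> [x y [Ax|->] [Ay|->]|x Sx [Ax|//]]; rewrite ?addr0 ?add0r; auto.
exists (Submod Az Aadd) => //= x; apply: contrapT => nx; apply: (nx).
have Ax : A x.
  (* This enlargement is the span of [A] and [x]; it meets [S] trivially exactly because [x] is not
     a sum from [S] and [A]. *)
  apply: (Aext (fun z => A z \/ A (z + x))); [by left | | by right; rewrite addrr2].
  split=> [y z [Ay|Ay] [Az'|Az']|y Sy [Ay|Ay]].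
  - by left; apply: Aadd.
  - by right; rewrite -addrA; apply: Aadd.
  - by right; rewrite addrAC; apply: Aadd.
  - by left; rewrite -[y + z]addr0 -(addrr2 x) addrACA; apply: Aadd.
  - exact: A0.
  - by case: nx; exists y; rewrite ?oppr2 1?addrC.
by exists 0; [apply: submod0 | rewrite subr0].
Qed.

(** With [C] complementing the kernel and [D] the image, [r x] is the only [y] in [C] with [x - q y]
    in [D]. Choice picks [r] pointwise; uniqueness makes it additive. *)
Lemma generalized_inverse_exists M N (q : M -> N) : {morph q : x y / x + y} ->
  exists2 r : N -> M, {morph r : x y / x + y} & forall x, q (r (q x)) = q x.
Proof.
move=> qD; have q0 : q 0 = 0 by apply: (addrI (q 0)); rewrite -qD !addr0.
have kerD x y : q x = 0 -> q y = 0 -> q (x + y) = 0.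
  by move=> qx qy; rewrite qD qx qy addr0.
have imD x y : (exists z, q z = x) -> (exists z, q z = y) -> exists z, q z = x + y.
  by move=> [z <-] [t <-]; exists (z + t).
have [C C0 CP] := complement_exists (@Submod M (fun x => q x = 0) q0 kerD).
have [D D0 DP] :=
  complement_exists (@Submod N (fun x => exists z, q z = x) (ex_intro _ 0 q0) imD).
have [r rP] : {r : N -> M & forall x, C (r x) /\ D (x - q (r x))}.
  apply: (choice (P := fun x y => C y /\ D (x - q y))) => x.
  have [_ [z <-] Dz] := DP x; have [k /= kq Ck] := CP z.
  by exists (z - k); split=> //; rewrite qD (oppr2 k) kq addr0.
have uniq x y y' : C y -> D (x - q y) -> C y' -> D (x - q y') -> y = y'.
  move=> Cy Dy Cy' Dy'; apply/eqP; rewrite -subr_eq0; apply/eqP; apply: C0.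
    apply: D0; first by exists (y - y').
    rewrite qD !oppr2; have := submodD Dy Dy'.
    by rewrite !oppr2 addrACA addrr2 add0r.
  by rewrite oppr2; apply: submodD.
exists r => [x y|x].
  have [Cx Dx] := rP x; have [Cy Dy] := rP y; have [Cxy Dxy] := rP (x + y).
  apply: uniq Cxy Dxy _ _; first exact: submodD.
  by rewrite qD opprD addrACA; apply: submodD.
have [Cx Dx] := rP (q x); apply/esym/eqP; rewrite -subr_eq0; apply/eqP.
by apply: D0 => //; exists (x - r (q x)); rewrite qD !oppr2.
Qed.

(* Embed [M] in the Boolean ring of functions on its dual; a linear retraction
   carries the pointwise product over to [M]. *)
Lemma idempotent_product_exists M :
  exists p : M -> M -> M, [/\ forall x y z, p (x + y) z = p x z + p y z,
    forall x y, p x y = p y x & forall x, p x x = x].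
Proof.
pose dual := {f : M -> 'F_2 | {morph f : x y / x + y}}.
pose ev (x : M) : dual -> ('F_2)^o := fun f => sval f x.
have evD : {morph ev : x y / x + y}.
  by move=> x y; apply/funext => f; rewrite /ev (svalP f).
have [r rD rK] := generalized_inverse_exists evD.
have ev_inj x : ev x = 0 -> x = 0.
  move=> evx; apply: contrapT => nx.
  (* A generalized inverse [f] of [a |-> a *: x] is a functional with [f x *: x = x], so functionals
     separate points. *)
  pose i (a : ('F_2)^o) : M := a *: x.
  have iD : {morph i : a b / a + b} by move=> a b; rewrite /i scalerDl.
  have [f fD fK] := generalized_inverse_exists iD.
  have := congr1 (fun h => h (exist _ f fD : dual)) evx; rewrite /ev /= => fx.
  by apply: nx; have := fK 1; rewrite /i scale1r fx scale0r.
exists (fun x y => r (fun f => ev x f * ev y f)); split=> [x y z|x y|x].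
- rewrite -rD; congr r; apply/funext => f; rewrite evD; exact: mulrDl.
- by congr r; apply/funext => f; rewrite mulrC.
- have -> : (fun f => ev x f * ev x f) = ev x.
    apply/funext => f; case: (F2_cases (ev x f)) => ->; exact/val_inj.
  apply/eqP; rewrite -subr_eq0; apply/eqP; apply: ev_inj.
  by rewrite oppr2 evD rK; apply/funext => f; apply: (addrr2 (ev x f : ('F_2)^o)).
Qed.

End LinearAlgebra.

(** * Transport between possibly different bidegrees *)

Section ConditionalCast.
Variable M : wgmod.

(* Zero when the bidegrees differ. *)
Definition zcast (b b' : bideg) (x : M b) : M b' :=
  if pselect (b = b') is left e then cast e x else 0.

Lemma zcastE b b' (e : b = b') (x : M b) : zcast b' x = cast e x.
Proof.
by rewrite /zcast; case: pselect => // e'; rewrite (Prop_irrelevance e e').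
Qed.

Lemma zcast_id b (x : M b) : zcast b x = x.
Proof. exact: (zcastE (erefl b)). Qed.

Lemma zcast_neq b b' (x : M b) : b <> b' -> zcast b' x = 0.
Proof. by rewrite /zcast; case: pselect. Qed.

Lemma zcast_cast b b' b'' (e : b = b') (x : M b) : zcast b'' (cast e x) = zcast b'' x.
Proof. by case: b' / e. Qed.

Lemma zcast0 b b' : zcast b' (0 : M b) = 0.
Proof. by rewrite /zcast; case: pselect => // e; apply: cast0. Qed.

Lemma zcastD b b' (x y : M b) : zcast b' (x + y) = zcast b' x + zcast b' y.
Proof. by rewrite /zcast; case: pselect => [e|_]; [case: b' / e | rewrite addr0]. Qed.

Lemma cast_zcast b b' b'' (e : b' = b'') (x : M b) : cast e (zcast b' x) = zcast b'' x.
Proof. by case: b'' / e. Qed.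

End ConditionalCast.

Lemma zcast_hom (M N : wgmod) (f : wghom M N) b b' (x : M b) :
  f _ (zcast b' x) = zcast b' (f _ x).
Proof.
by rewrite /zcast; case: pselect => [e|_]; [exact: cast_hom | exact: linear0].
Qed.

Lemma castD (M : wgmod) b b' (e : b = b') (x y : M b) :
  cast e (x + y) = cast e x + cast e y.
Proof. by case: b' / e. Qed.

Lemma castMn (M : wgmod) b b' (e : b = b') (x : M b) n : cast e (x *+ n) = cast e x *+ n.
Proof. by case: b' / e. Qed.

Lemma castKV (M : wgmod) b b' (e : b = b') (x : M b') : cast e (cast (esym e) x) = x.
Proof. by case: b' / e x. Qed.

(** * Weights below four *)

Definition low (b : bideg) : bool := (weight b <? 4)%positive.

Lemma lowP b : reflect (weight b < 4)%positive (low b).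
Proof. by apply: (iffP idP) => /Pos.ltb_lt. Qed.

Lemma low_Qdeg j b : low (Qdeg j b) -> weight b = 1%positive.
Proof. by move/lowP; rewrite /weight /=; lia. Qed.

Lemma low_brdeg a b : low (brdeg a b) -> low a /\ low b.
Proof.
by move/lowP; rewrite /weight /= => h; split; apply/lowP; rewrite /weight; lia.
Qed.

Lemma weight_brdeg a b : weight (brdeg a b) = (weight a + weight b)%positive.
Proof. by []. Qed.

Lemma low_weight1 b : weight b = 1%positive -> low b.
Proof. by rewrite /low => ->. Qed.

(* The bidegree of [x] when [Q_0 x] has bidegree [b]. *)
Definition halfdeg (b : bideg) : bideg := (1%positive, ((b.2 + 1) %/ 2)%Z).

Lemma halfdeg_self b : weight b = 1%positive -> halfdeg (brdeg b b) = b.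
Proof. by case: b => w d /= ->; rewrite /halfdeg /=; congr pair; lia. Qed.

(** * Twisting the bracket by a form *)

Section Twist.
Variable M : wgmod.

(** No relation between the three bidegrees is imposed, so the laws involve no transport; [kappa]
    evaluates at the one [e] that matters. *)
Record twisting := Twisting {
  tform : forall a b e : bideg, M a -> M b -> M e;
  tformDl : forall a b e (x x' : M a) (y : M b),
    tform e (x + x') y = tform e x y + tform e x' y;
  tformC : forall a b e (x : M a) (y : M b), tform e x y = tform e y x;
  tform_idem : forall b (x : M b), weight b = 1%positive -> tform b x x = x }.

Variables (o : ops M) (c : twisting).
Local Notation Q := (@Qop M o).

(** [halfdeg] rounds down and ignores the weight; [zcast] makes the term vanish outside total weight
    two and in the degrees that [Q_0] cannot reach. *)
Definition kappa a b (x : M a) (y : M b) : M (brdeg a b) :=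
  zcast (brdeg a b) (Qlow Q 0 (tform c (halfdeg (brdeg a b)) x y)).

Lemma kappa_weight a b (x : M a) (y : M b) :
  weight (brdeg a b) <> 2%positive -> kappa x y = 0.
Proof. by move=> h; apply: zcast_neq => e; apply: h; rewrite -e. Qed.

(* Adds [Q_0 (tform x y)] to the bracket of elements of weight one, and discards
   the operations landing in weight at least four. *)
Definition tw_ops : ops M :=
  Ops (fun j b x => Qop o j x *+ low (Qdeg j b))
      (fun a b x y => (br o x y + kappa x y) *+ low (brdeg a b)).

Hypothesis allo : allowable (@Qop M o).
Hypothesis lieo : lie_s (@br M o).
Hypothesis brQo : br_Q_zero o.

Lemma Qlow0D b (x y : M b) : Qlow Q 0 (x + y) = Qlow Q 0 x + Qlow Q 0 y.
Proof. exact: Q_additive allo _ _ _ _. Qed.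

Lemma kappaDl a b (x x' : M a) (y : M b) : kappa (x + x') y = kappa x y + kappa x' y.
Proof. by rewrite /kappa tformDl Qlow0D zcastD. Qed.

Lemma kappaC a b (x : M a) (y : M b) : kappa x y = cast (brdegC b a) (kappa y x).
Proof. by rewrite /kappa cast_zcast tformC (brdegC b a). Qed.

Lemma kappaDr a b (x : M a) (y y' : M b) : kappa x (y + y') = kappa x y + kappa x y'.
Proof. by rewrite kappaC kappaDl castD -!kappaC. Qed.

Lemma kappa_self b (x : M b) : weight b = 1%positive ->
  kappa x x = cast (esym (Qdeg_self b)) (Qlow Q 0 x).
Proof.
move=> wb; rewrite /kappa -zcastE.
(* The index is generalized before [halfdeg_self] is substituted, because the type of the form's
   value depends on it. *)
have -> : forall e, e = b ->
    zcast (brdeg b b) (Qlow Q 0 (tform c e x x)) = zcast (brdeg b b) (Qlow Q 0 x).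
  by move=> e ->; rewrite tform_idem.
by []. exact: halfdeg_self.
Qed.

Lemma br0 a b (x : M a) : br o x (0 : M b) = 0.
Proof. by apply: (addrI (br o x (0 : M b))); rewrite -(br_addr lieo) !addr0. Qed.

Lemma br_zcast_Q a b b' j (x : M a) (y : M b) : br o x (zcast b' (Qop o j y)) = 0.
Proof.
rewrite /zcast; case: pselect => [e|_]; last exact: br0.
by case: b' / e; apply: brQo.
Qed.

(** Composites of two operations have weight at least four, so truncation kills both sides of the
    Adem relation. *)
Lemma tw_allowable : allowable (@Qop M tw_ops).
Proof.
split=> [j b x y|j b x lt_jb|a b d x _] /=.
- by rewrite (Q_additive allo) mulrnDl.
- by rewrite (Q_unstable allo) // mul0rn.
- rewrite /Qlow /=.
  have nlow i j e : low (Qdeg i (Qdeg j e)) = false.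
    by apply/lowP; rewrite /weight /=; lia.
  by rewrite nlow mulr0n big1 // => i _; rewrite nlow mulr0n cast0 mul0rn.
Qed.

(** The inner [kappa] is a value of [Q], which brackets annihilate, and the outer one would sit in
    total weight at least three. The Jacobi identity is thus inherited. *)
Lemma tw_br_br a b d (x : M a) (y : M b) (z : M d) :
  br tw_ops x (br tw_ops y z) = br o x (br o y z) *+ low (brdeg a (brdeg b d)).
Proof.
rewrite /=; case: (boolP (low (brdeg a (brdeg b d)))) => // lw.
have [_ lw'] := low_brdeg lw; rewrite lw' !mulr1n (br_addr lieo) br_zcast_Q addr0.
rewrite kappa_weight ?addr0 // => w2.
by have := congr1 Pos.to_nat w2; rewrite !weight_brdeg; lia.
Qed.

Lemma tw_lie : lie_s (@br M tw_ops).
Proof.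
split=> [a b x x' y|a b x y y'|a b x y|a b d x y z].
- by rewrite /= (br_addl lieo) kappaDl addrACA mulrnDl.
- by rewrite /= (br_addr lieo) kappaDr addrACA mulrnDl.
- by rewrite /= castMn castD -kappaC -(br_comm lieo) (brdegC b a).
- have lr1 : low (brdeg b (brdeg d a)) = low (brdeg a (brdeg b d)).
    by rewrite -brdeg_rot.
  have lr2 : low (brdeg d (brdeg a b)) = low (brdeg a (brdeg b d)).
    by rewrite brdeg_rot.
  rewrite !tw_br_br lr1 lr2 !castMn -!mulrnDl.
  by rewrite (br_jacobi lieo) mul0rn.
Qed.

Lemma tw_br_Q : br_Q_zero tw_ops.
Proof.
move=> j a b x y /=; case: (boolP (low (brdeg _ _))) => // lw.
have [_ lw'] := low_brdeg lw; rewrite lw' !mulr1n brQo kappa_weight ?addr0 //.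
by move=> w2; have := congr1 Pos.to_nat w2; rewrite weight_brdeg /weight /=; lia.
Qed.

End Twist.

(** Only two varieties exist, so [v <> v'] covers both directions. A self-bracket below weight four
    comes from weight one, where [kappa x x] is [Q_0 x]: added to [[x, x] = Q_0 x] it gives 0, added
    to 0 it gives [Q_0 x]. From weight four on, truncation makes both sides zero. *)
Lemma tw_laws v v' (A : algebra v') (c : twisting A) :
  v <> v' -> laws v (tw_ops (opsof A) c).
Proof.
have twa := tw_allowable c (alg_allowable A).
have twl := tw_lie c (alg_allowable A) (alg_lie_s A) (@alg_br_Q _ A).
have twq := @tw_br_Q _ _ c (@alg_br_Q _ A).
have self b (x : A b) : low (brdeg b b) -> weight b = 1%positive.
  by move/lowP; rewrite weight_brdeg; lia.
case: v' A c twa twl twq self => A c twa twl twq self; case: v => // _; split=> //.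
  split=> // b x /=; case: (boolP (low _)) => // lw.
  rewrite (kappa_self _ _ _ (self _ x lw)) (lie_s_R_Q0 (lawsof A)).
  by case: _ / (Qdeg_self b) => /=; rewrite addrr2.
move=> b x; have lq : low (Qdeg (b.2 + 0) b) = low (brdeg b b) by rewrite -Qdeg_self.
rewrite /Qlow /= castMn lq; case: (boolP (low (brdeg b b))) => // lw.
rewrite (lie_s_ti_self (lie_s_ti_R_lie (lawsof A))) add0r kappa_self ?(self _ x lw) //.
by rewrite castKV.
Qed.

Definition tw_alg v v' (A : algebra v') (c : twisting A) (neq : v <> v') : algebra v :=
  Algebra (tw_laws c neq).

(** * Homomorphisms and forms below weight four *)

Record is_alghom_low (M N : wgmod) (oM : ops M) (oN : ops N) (f : wghom M N) : Prop := {
  alghom_lowQ : forall j b (x : M b), low (Qdeg j b) ->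
    f _ (Qop oM j x) = Qop oN j (f _ x);
  alghom_low_br : forall a b (x : M a) (y : M b), low (brdeg a b) ->
    f _ (br oM x y) = br oN (f _ x) (f _ y) }.

Lemma alghom_alghom_low (M N : wgmod) (oM : ops M) (oN : ops N) (f : wghom M N) :
  is_alghom oM oN f -> is_alghom_low oM oN f.
Proof. by case=> fQ fB; split=> *. Qed.

Lemma alghom_low_comp (M N P : wgmod) (oM : ops M) (oN : ops N) (oP : ops P)
    (f : wghom M N) (g : wghom N P) :
  is_alghom_low oM oN f -> is_alghom_low oN oP g ->
  is_alghom_low oM oP (fun b => g b \o f b).
Proof. by move=> [fQ fB] [gQ gB]; split=> * /=; rewrite ?fQ ?fB ?gQ ?gB. Qed.

(** Subterms never weigh more than the term, so induction on terms stays below weight four. The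
    target has bare operations, which admits iterated twists. *)
Lemma free_hom_eq_low v (X N : wgmod) (oN : ops N) (h h' : wghom (free_mod v X) N) :
  is_alghom_low (free_ops v X) oN h -> is_alghom_low (free_ops v X) oN h' ->
  (forall b x, low b -> h b (free_unit v X b x) = h' b (free_unit v X b x)) ->
  forall b x, low b -> h b x = h' b x.
Proof.
case=> hQ hB [hQ' hB'] hE b; elim/f2quotW=> t.
elim: b / t => [b x|b|b s IHs t IHt|j b t IHt|a b s IHs t IHt] lw.
- exact: hE.
- by rewrite (to_f2quot0 (term_pre v X b)) !linear0.
- by rewrite (to_f2quotD (s : term_pre v X b) t) !linearD IHs ?IHt.
- have -> : to_f2quot (TQ j t : term_pre v X _)
      = Qop (free_ops v X) j (to_f2quot (t : term_pre v X b)).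
    apply/to_f2quotP => B g /=.
    by rewrite (f2repr_to (t : term_pre v X _)).
  by rewrite hQ // hQ' // IHt // low_weight1 // (low_Qdeg lw).
- have -> : to_f2quot (TBr s t : term_pre v X _)
      = br (free_ops v X) (to_f2quot (s : term_pre v X a))
          (to_f2quot (t : term_pre v X b)).
    apply/to_f2quotP => B g /=.
    by rewrite (f2repr_to (s : term_pre v X _)) (f2repr_to (t : term_pre v X _)).
  by have [la lb] := low_brdeg lw; rewrite hB // hB' // IHs ?IHt.
Qed.

(* Operations raise the weight, so weight one consists of generators. *)
Lemma free_unit_act v (A : algebra v) b (x : free_mod v A b) :
  weight b = 1%positive -> free_unit v A b (act A b x) = x.
Proof.
move=> wb; have lQ j e : weight (Qdeg j e) <> 1%positive by [].
have lB d e : weight (brdeg d e) <> 1%positive by rewrite weight_brdeg; lia.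
suff H e (y : free_mod v A e) : weight e = 1%positive -> exists z, y = free_unit v A e z.
  by have [z ->] := H b x wb; rewrite act_unit.
elim/f2quotW: y => t; elim: e / t => [e y|e|e s IHs t IHt|j e t IHt|d e s IHs t IHt].
- by exists y.
- by exists 0; rewrite linear0 (to_f2quot0 (term_pre v A e)).
- move=> we; have [y ys] := IHs we; have [z zt] := IHt we; exists (y + z).
  by rewrite linearD -ys -zt (to_f2quotD (s : term_pre v A e) t).
- by move/lQ.
- by move/lB.
Qed.

(** Restricted to low weights because the comparison maps below respect structure maps only
    there. *)
Definition form_compat (M N : wgmod) (cM : twisting M) (cN : twisting N)
    (f : wghom M N) : Prop :=
  forall a b e (x : M a) (y : M b), low a -> low b -> low e ->
    f e (tform cM e x y) = tform cN e (f _ x) (f _ y).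

Lemma kappa_hom_low (M N : wgmod) (oM : ops M) (oN : ops N) (cM : twisting M)
    (cN : twisting N) (f : wghom M N) :
  (forall j b (x : M b), low (Qdeg j b) -> f _ (Qop oM j x) = Qop oN j (f _ x)) ->
  form_compat cM cN f -> forall a b (x : M a) (y : M b), low (brdeg a b) ->
    f _ (kappa oM cM x y) = kappa oN cN (f _ x) (f _ y).
Proof.
move=> fQ fc a b x y lw; have [la lb] := low_brdeg lw.
by rewrite /kappa zcast_hom /Qlow fQ // fc.
Qed.

Lemma tw_hom_low (M N : wgmod) (oM : ops M) (oN : ops N) (cM : twisting M)
    (cN : twisting N) (f : wghom M N) :
  is_alghom_low oM oN f -> form_compat cM cN f ->
  is_alghom_low (tw_ops oM cM) (tw_ops oN cN) f.
Proof.
move=> hf fc; split=> [j b x lw|a b x y lw]; rewrite /= lw !mulr1n.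
  exact: (alghom_lowQ hf).
by rewrite linearD (alghom_low_br hf) // (kappa_hom_low (alghom_lowQ hf) fc).
Qed.

(** Both twists add the same [kappa], since twisting leaves the low operations [Q] alone; the two
    copies cancel in characteristic two. *)
Lemma tw_tw_hom_low (M : wgmod) (o : ops M) (c : twisting M) :
  is_alghom_low o (tw_ops (tw_ops o c) c) (fun b => idfun).
Proof.
split=> [j b x lw|a b x y lw]; rewrite /= lw !mulr1n //.
have <- : kappa o c x y = kappa (tw_ops o c) c x y; last by rewrite -addrA addrr2 addr0.
by apply: (kappa_hom_low (f := fun b => idfun)) => // j d z ld; rewrite /= ld.
Qed.

(** The added term is a value of [Q_0], which maps to zero in a trivial algebra; augmentations
    therefore do not see the twist. *)
Lemma tw_triv_hom (M N : wgmod) (oM : ops M) (c : twisting M) (f : wghom M N) :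
  is_alghom oM (triv_ops N) f -> is_alghom_low (tw_ops oM c) (triv_ops N) f.
Proof.
move=> [fQ fB]; split=> [j b x lw|a b x y lw]; rewrite /= lw mulr1n; first exact: fQ.
by rewrite linearD fB zcast_hom /Qlow fQ zcast0 addr0.
Qed.

(** * Propagating a form to free algebras *)

Section FreeTwisting.
Variables (v : variety) (A : algebra v) (c : twisting A).

(** Pullback along the structure map followed by the unit. In weight one these are mutually inverse,
    whence idempotence. *)
Definition free_form a b e (x : free_mod v A a) (y : free_mod v A b) : free_mod v A e :=
  free_unit v A e (tform c e (act A a x) (act A b y)).

Program Definition free_twisting : twisting (free_mod v A) :=
  @Twisting _ free_form _ _ _.
Next Obligation. by rewrite /free_form !linearD tformDl linearD. Qed.
Next Obligation. by rewrite /free_form tformC. Qed.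
Next Obligation. by rewrite /free_form tform_idem // free_unit_act. Qed.

Lemma act_form : form_compat free_twisting c (act A).
Proof. by move=> a b e x y _ _ _; exact: act_unit. Qed.

End FreeTwisting.

Lemma free_map_form v (A B : algebra v) (cA : twisting A) (cB : twisting B)
    (f : wghom A B) :
  is_alghom (opsof A) (opsof B) f -> form_compat cA cB f ->
  form_compat (free_twisting cA) (free_twisting cB) (free_map v f).
Proof.
move=> hf fc a b e x y la lb le.
by rewrite /= /free_form !(act_natural hf) -fc //; exact: free_map_unit.
Qed.

Fixpoint bar_twisting v (A : algebra v) (c : twisting A) n : twisting (bar_alg A n) :=
  if n is m.+1 then free_twisting (bar_twisting c m) else c.

(** * Comparison of the two bar constructions *)

Section Comparison.
Variables (v v' : variety) (neq : v <> v') (A : algebra v) (A' : algebra v').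
Variables (c' : twisting A') (phi : wghom A A').
Hypothesis phi_hom : is_alghom_low (opsof A) (tw_ops (opsof A') c') phi.

(** The twisted free [v']-algebra is a [v]-algebra, so the universal property of the free
    [v]-algebra extends the previous level. *)
Fixpoint bar_comparison n : wghom (bar_obj A n) (bar_obj A' n) :=
  if n is m.+1 then
    free_ext (A := tw_alg (bar_twisting c' m.+1) neq)
      (fun b => free_unit v' (bar_obj A' m) b \o bar_comparison m b)
  else phi.
Local Notation Phi := bar_comparison.

Lemma bar_comparison_hom n :
  is_alghom_low (opsof (bar_alg A n)) (tw_ops (opsof (bar_alg A' n)) (bar_twisting c' n))
    (Phi n).
Proof.
case: n => [//|n]; apply: alghom_alghom_low.
exact: (free_ext_hom (A := tw_alg (bar_twisting c' n.+1) neq)).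
Qed.

Lemma bar_comparison_unit n b x :
  Phi n.+1 b (free_unit v (bar_obj A n) b x) = free_unit v' (bar_obj A' n) b (Phi n b x).
Proof. exact: (free_ext_unit (A := tw_alg (bar_twisting c' n.+1) neq)). Qed.

(** Both composites are low homomorphisms out of a free algebra into a twisted one, so generators
    decide. Compatibility with the forms is what keeps the structure map a homomorphism after
    twisting; the inner faces are treated alike. *)
Lemma bar_comparison_act n b x : low b ->
  Phi n b (act (bar_alg A n) b x) = act (bar_alg A' n) b (Phi n.+1 b x).
Proof.
apply: (free_hom_eq_low (oN := tw_ops (opsof (bar_alg A' n)) (bar_twisting c' n))
  (h := fun b => Phi n b \o act (bar_alg A n) b)
  (h' := fun b => act (bar_alg A' n) b \o Phi n.+1 b)) => [||{}b {}x _].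
- exact: alghom_low_comp (alghom_alghom_low (act_hom _)) (bar_comparison_hom n).
- apply: alghom_low_comp (bar_comparison_hom n.+1) _.
  exact: tw_hom_low (alghom_alghom_low (act_hom _)) (@act_form _ _ _).
- change (Phi n b (act (bar_alg A n) b (free_unit v (bar_obj A n) b x))
    = act (bar_alg A' n) b (Phi n.+1 b (free_unit v (bar_obj A n) b x))).
  by rewrite bar_comparison_unit !act_unit.
Qed.

Lemma bar_inner_form n i : (i <= n)%N ->
  form_compat (bar_twisting c' n.+1) (bar_twisting c' n) (bar_inner A' n i).
Proof.
elim: n i => [|n IHn] [|i] // le_in; try exact: act_form.
by apply: free_map_form; [exact: bar_inner_hom | exact: IHn].
Qed.

Lemma bar_comparison_inner n i b x : (i <= n)%N -> low b ->
  Phi n b (bar_inner A n i b x) = bar_inner A' n i b (Phi n.+1 b x).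
Proof.
elim: n i b x => [|n IHn] [|i] b x // le_in; try exact: bar_comparison_act.
apply: (free_hom_eq_low
  (oN := tw_ops (opsof (bar_alg A' n.+1)) (bar_twisting c' n.+1))
  (h := fun b => Phi n.+1 b \o free_map v (bar_inner A n i) b)
  (h' := fun b => free_map v' (bar_inner A' n i) b \o Phi n.+2 b)) => [||{}b {}x lb].
- exact: alghom_low_comp (alghom_alghom_low (free_map_hom _ _)) (bar_comparison_hom n.+1).
- apply: alghom_low_comp (bar_comparison_hom n.+2) _.
  exact: tw_hom_low (alghom_alghom_low (free_map_hom _ _)) (bar_inner_form le_in).
- change (Phi n.+1 b (free_map v (bar_inner A n i) b (free_unit v (bar_obj A n.+1) b x))
    = free_map v' (bar_inner A' n i) b (Phi n.+2 b (free_unit v (bar_obj A n.+1) b x))).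
  by rewrite bar_comparison_unit !free_map_unit -IHn // -bar_comparison_unit.
Qed.

Lemma bar_comparison_aug n b x : low b ->
  Phi n b (aug v (bar_obj A n) b x) = aug v' (bar_obj A' n) b (Phi n.+1 b x).
Proof.
apply: (free_hom_eq_low (oN := triv_ops (bar_obj A' n))
  (h := fun b => Phi n b \o aug v (bar_obj A n) b)
  (h' := fun b => aug v' (bar_obj A' n) b \o Phi n.+1 b)) => [||{}b {}x _].
- apply: alghom_low_comp (alghom_alghom_low (aug_hom v _)) _.
  exact: alghom_alghom_low (triv_hom _).
- exact: alghom_low_comp (bar_comparison_hom n.+1) (tw_triv_hom _ (aug_hom _ _)).
- change (Phi n b (aug v (bar_obj A n) b (free_unit v (bar_obj A n) b x))
    = aug v' (bar_obj A' n) b (Phi n.+1 b (free_unit v (bar_obj A n) b x))).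
  by rewrite bar_comparison_unit !aug_unit.
Qed.

Lemma bar_comparison_face n i b x : (i <= n.+1)%N -> low b ->
  Phi n b (face (Bar A) n i b x) = face (Bar A') n i b (Phi n.+1 b x).
Proof.
case: i => [|i] le_in lb; first exact: bar_comparison_aug.
exact: bar_comparison_inner.
Qed.

Lemma bar_comparison_form (c : twisting A) : form_compat c c' phi ->
  forall n, form_compat (bar_twisting c n) (bar_twisting c' n) (Phi n).
Proof.
move=> phic; elim=> [//|n IHn] a b e x y la lb le.
change (Phi n.+1 e (free_unit v (bar_obj A n) e (tform (bar_twisting c n) e
    (act (bar_alg A n) a x) (act (bar_alg A n) b y)))
  = free_unit v' (bar_obj A' n) e (tform (bar_twisting c' n) e
    (act (bar_alg A' n) a (Phi n.+1 a x)) (act (bar_alg A' n) b (Phi n.+1 b y)))).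
by rewrite bar_comparison_unit IHn // !bar_comparison_act.
Qed.

End Comparison.

(** The composite and the identity are both low homomorphisms into the doubly twisted free algebra,
    and by induction they agree on generators. *)
Lemma bar_comparisonK v v' (neq : v <> v') (neq' : v' <> v) (A : algebra v)
    (A' : algebra v') (c : twisting A) (c' : twisting A')
    (phi : wghom A A') (psi : wghom A' A)
    (hphi : is_alghom_low (opsof A) (tw_ops (opsof A') c') phi)
    (hpsi : is_alghom_low (opsof A') (tw_ops (opsof A) c) psi) :
  form_compat c' c psi -> (forall b x, low b -> psi b (phi b x) = x) ->
  forall n b x, low b ->
    bar_comparison neq' c psi n b (bar_comparison neq c' phi n b x) = x.
Proof.
move=> psic phiK; elim=> [//|n IHn] b x lb.
have hP := bar_comparison_hom neq hphi n.+1.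
have hS := bar_comparison_hom neq' hpsi n.+1.
have cS : form_compat (bar_twisting c' n.+1) (bar_twisting c n.+1)
    (bar_comparison neq' c psi n.+1) by apply: bar_comparison_form.
pose h b := bar_comparison neq' c psi n.+1 b \o bar_comparison neq c' phi n.+1 b.
apply: (free_hom_eq_low (h := h) (h' := fun b => idfun)
  (oN := tw_ops (tw_ops (free_ops v (bar_obj A n)) (bar_twisting c n.+1))
     (bar_twisting c n.+1))) lb => [||{}b {}x lb].
- exact: alghom_low_comp hP (tw_hom_low hS cS).
- exact: tw_tw_hom_low.
- change (bar_comparison neq' c psi n.+1 b (bar_comparison neq c' phi n.+1 b
    (free_unit v (bar_obj A n) b x)) = free_unit v (bar_obj A n) b x).
  by rewrite !bar_comparison_unit IHn.
Qed.

(** * Maps on homotopy groups induced by face-preserving maps in one bidegree *)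

Section HomotopyMap.
Variables (X Y : simplicial) (b : bideg) (f : forall n, {linear X n b -> Y n b}).
Hypothesis f_face : forall n i x, (i <= n.+1)%N ->
  f n (face X n i b x) = face Y n i b (f n.+1 x).

Lemma normalized_map n (x : X n b) : normalized x -> normalized (f n x).
Proof.
by case: n x => //= n x nx i le_in; rewrite -f_face ?nx ?linear0 // ltnW.
Qed.

Lemma ncycle_map n (x : X n b) : ncycle x -> ncycle (f n x).
Proof.
case: n x => // n x [nx cx]; split; first exact: (@normalized_map n.+1).
by rewrite -f_face // cx linear0.
Qed.

Lemma nboundary_map n (x : X n b) : nboundary x -> nboundary (f n x).
Proof.
case=> z nz <-; exists (f n.+1 z); first exact: normalized_map.
by rewrite f_face.
Qed.

Definition cycle_map n (x : subm (ncycles X n b)) : subm (ncycles Y n b) :=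
  subm_of (S := ncycles Y n b) (ncycle_map (submP x)).

Lemma cycle_mapD n : {morph @cycle_map n : x y / x + y}.
Proof. by move=> x y; apply: val_inj; rewrite /= linearD. Qed.

Definition homotopy_fun n (q : homotopy_group X n b) : homotopy_group Y n b :=
  quotm_proj (nboundaries Y n b) (cycle_map (f2repr q)).

(** Independence of the chosen representative: two of them differ by a boundary, and boundaries are
    preserved. *)
Lemma homotopy_fun_proj n (x : subm (ncycles X n b)) :
  homotopy_fun (quotm_proj (nboundaries X n b) x)
  = quotm_proj (nboundaries Y n b) (cycle_map x).
Proof.
apply/to_f2quotP; have := f2repr_to (x : quotm_pre (nboundaries X n b)).
by move/nboundary_map; rewrite /= linearB.
Qed.

Lemma homotopy_funD n : {morph @homotopy_fun n : x y / x + y}.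
Proof.
elim/f2quotW=> x; elim/f2quotW=> y; rewrite -to_f2quotD.
rewrite -!/(quotm_proj (nboundaries X n b) _) !homotopy_fun_proj.
by rewrite -linearD -cycle_mapD.
Qed.

Definition homotopy_map n : {linear homotopy_group X n b -> homotopy_group Y n b} :=
  linear_of_additive (@homotopy_funD n).

End HomotopyMap.

Lemma homotopy_mapK (X Y : simplicial) b (f : forall n, {linear X n b -> Y n b})
    (g : forall n, {linear Y n b -> X n b})
    (f_face : forall n i x, (i <= n.+1)%N ->
      f n (face X n i b x) = face Y n i b (f n.+1 x))
    (g_face : forall n i x, (i <= n.+1)%N ->
      g n (face Y n i b x) = face X n i b (g n.+1 x)) :
  (forall n, cancel (f n) (g n)) ->
  forall n, cancel (homotopy_map f_face n) (homotopy_map g_face n).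
Proof.
move=> fK n; elim/f2quotW=> x.
rewrite -/(quotm_proj (nboundaries X n b) x).
rewrite [homotopy_map f_face n _]homotopy_fun_proj [LHS]homotopy_fun_proj.
have -> // : cycle_map g_face (cycle_map f_face x) = x.
by apply: val_inj; apply: fK.
Qed.

(** * The form on [g] that relates it to its associated algebra *)

Section SelfTwisting.
Variables (g : algebra LieSR) (s : splitting g).
Local Notation B := (br (opsof g)).
Local Notation q := (Qlow (@Qop g (opsof g)) 0).

Let lieg : lie_s (@br g (opsof g)) := alg_lie_s g.
Let qD b : {morph (q (b := b)) : x y / x + y} := Qlow0D (alg_allowable g) (b := b).

Lemma br_tildeE a b (x : g a) (y : g b) : br_tilde s x y = sec s _ (projV g _ (B x y)).
Proof. by rewrite /br_tilde /= /of_VxV'_fun /= brV_proj addr0. Qed.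

(** Self-brackets have even weight and in weight two equal [Q_0 z]; sums stay of this form as [Q_0]
    is additive. Bracketing with [Q_0 z] gives zero, so nothing survives in weight three. *)
Lemma self_ideal_low b (v : g b) : self_ideal v ->
  [/\ weight b = 1%positive -> v = 0,
    weight b = 2%positive -> exists z : g (halfdeg b), zcast b (q z) = v
    & weight b = 3%positive -> v = 0].
Proof.
have q0 e : q (0 : g e) = 0.
  by have := qD (0 : g e) 0; rewrite (addr0 (0 : g e)) addrr2.
elim=> {b v}[b x|b|b x y _ [x1 x2 x3] _ [y1 y2 y3]|a b x y _ [y1 y2 y3]].
- split; rewrite weight_brdeg => wb; try by exfalso; lia.
  have wb1 : weight b = 1%positive by lia.
  suff H e : e = b -> exists z : g e, zcast (brdeg b b) (q z) = B x x.
    exact/H/halfdeg_self.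
  by move=> ->; exists x; rewrite (lie_s_R_Q0 (lawsof g)) zcast_cast zcast_id.
- by split=> // _; exists 0; rewrite q0 zcast0.
- split=> wb; [by rewrite x1 ?y1 ?addr0 | | by rewrite x3 ?y3 ?addr0].
  have [z <-] := x2 wb; have [t <-] := y2 wb.
  by exists (z + t); rewrite qD zcastD.
- split; rewrite weight_brdeg => wb; first by exfalso; lia.
    exists 0; rewrite q0 zcast0 y1; last by lia.
    by rewrite (br0 lieg).
  have [wb1|wb2] : weight b = 1%positive \/ weight b = 2%positive by lia.
    by rewrite (y1 wb1) (br0 lieg).
  by have [z <-] := y2 wb2; apply: br_zcast_Q lieg (@alg_br_Q _ g) _ _ _ _ _ _.
Qed.

(* The [V']-component of the bracket. *)
Definition self_part a b (x : g a) (y : g b) : g (brdeg a b) := B x y + br_tilde s x y.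

Lemma self_part_ideal a b (x : g a) (y : g b) : self_ideal (self_part x y).
Proof. rewrite /self_part br_tildeE -[sec _ _ _]oppr2; exact: split_ker. Qed.

Definition q_inv e := cid2 (generalized_inverse_exists (@qD e)).

Definition idem_product e := cid (idempotent_product_exists (g e)).

(** Write [r] for [q_inv e]. The summand [r (self_part x y)] is a preimage under [q] when one
    exists, but on the diagonal it is only [r (q x)]. The correction [p + r (q p)] lies in the
    kernel of [q] and turns this into [x], as [p = x] there. *)
Definition self_form a b e (x : g a) (y : g b) : g e :=
  let p := sval (idem_product e) (zcast e x) (zcast e y) in
  s2val (q_inv e) (zcast _ (self_part x y)) + (p + s2val (q_inv e) (q p)).

Lemma q_self_form a b e (x : g a) (y : g b) :
  q (self_form e x y) = q (s2val (q_inv e) (zcast _ (self_part x y))).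
Proof. by rewrite /self_form !qD (s2valP' (q_inv e)) addrr2 [LHS]addr0. Qed.

Program Definition self_twisting : twisting g := @Twisting g self_form _ _ _.
Next Obligation.
have rD := s2valP (q_inv e); have [pD _ _] := svalP (idem_product e).
rewrite /self_form /self_part (br_addl lieg).
rewrite (br_addl (lie_s_ti_lie (br_tilde_lie_s_ti s))) addrACA !zcastD pD qD !rD.
by rewrite [X in _ + X = _]addrACA [LHS]addrACA.
Qed.
Next Obligation.
have [_ pC _] := svalP (idem_product e).
rewrite /self_form pC /self_part (br_comm lieg).
by rewrite (br_comm (lie_s_ti_lie (br_tilde_lie_s_ti s))) -castD zcast_cast.
Qed.
Next Obligation.
have [_ _ pI] := svalP (idem_product b).
rewrite /self_form zcast_id pI /self_part.
rewrite (lie_s_ti_self (br_tilde_lie_s_ti s)) (addr0 (B x x)).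
rewrite (zcastE (Qdeg_self b)) -(lie_s_R_Q0 (lawsof g)).
by rewrite addrCA addrr2 [LHS]addr0.
Qed.

Lemma kappa_self_twisting a b (x : g a) (y : g b) : low (brdeg a b) ->
  kappa (opsof g) self_twisting x y = self_part x y.
Proof.
move=> lw; have [_ v2 v3] := self_ideal_low (self_part_ideal x y).
have [w2|w3] : weight (brdeg a b) = 2%positive \/ weight (brdeg a b) = 3%positive.
  by move/lowP: lw; rewrite weight_brdeg; lia.
  have [z qz] := v2 w2.
  (* In weight two the self part is [q z], and [q r q = q] recovers it; if the degrees disagree,
     both sides are zero. *)
  suff H e m (t : g e) :
      zcast m (q (s2val (q_inv e) (zcast _ (zcast m (q t))))) = zcast m (q t).
    by rewrite /kappa [tform _ _ _ _]/= q_self_form -qz; apply: H.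
  have [em|ne] := pselect (Qdeg (e.2 + 0) e = m); last by rewrite !zcast_neq.
  by case: m / em; rewrite !zcast_id (s2valP' (q_inv e)).
by rewrite kappa_weight ?w3 // v3.
Qed.

Lemma id_hom_tilde :
  is_alghom_low (opsof g) (tw_ops (ops_tilde s) self_twisting) (fun b => idfun).
Proof.
split=> [j b x lw|a b x y lw] /=; rewrite lw mulr1n //.
(* [kappa] depends on the operations only through [Q], which [ops_tilde] shares with [g]. *)
rewrite [kappa _ _ _ _](kappa_self_twisting x y lw).
by rewrite /self_part addrCA addrr2 addr0.
Qed.

Lemma id_tilde_hom :
  is_alghom_low (ops_tilde s) (tw_ops (opsof g) self_twisting) (fun b => idfun).
Proof.
split=> [j b x lw|a b x y lw] /=; rewrite lw mulr1n //.
by rewrite kappa_self_twisting // /self_part addrA addrr2 add0r.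
Qed.

End SelfTwisting.

Theorem corollary3p7 (g : algebra LieSR) (s : splitting g) (n : nat) (b : bideg) :
  (weight b < 4)%positive ->
  isomorphic (homotopy_group (Bar g) n b)
             (homotopy_group (Bar (assoc_alg s)) n b).
Proof.
move=> /lowP lb.
have neq : LieSR <> LieStiR by []; have neq' : LieStiR <> LieSR by [].
(* [g] and its associated algebra have the same carrier, so a single form serves both directions,
   with the identity as map at level zero. *)
pose c := self_twisting s; pose g' := assoc_alg s.
have hf := id_hom_tilde s; have hh := id_tilde_hom s.
pose f n : {linear Bar g n b -> Bar g' n b} :=
  bar_comparison (A := g) (A' := g') neq c (fun b => idfun) n b.
pose h n : {linear Bar g' n b -> Bar g n b} :=
  bar_comparison (A := g') (A' := g) neq' c (fun b => idfun) n b.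
have f_face k i x : (i <= k.+1)%N ->
    f k (face (Bar g) k i b x) = face (Bar g') k i b (f k.+1 x).
  by move=> le_ik; apply: bar_comparison_face.
have h_face k i x : (i <= k.+1)%N ->
    h k (face (Bar g') k i b x) = face (Bar g) k i b (h k.+1 x).
  by move=> le_ik; apply: bar_comparison_face.
have cc : form_compat c c (fun b => idfun) by [].
exists (homotopy_map (X := Bar g) (Y := Bar g') f_face n).
exists (homotopy_map (X := Bar g') (Y := Bar g) h_face n); apply: homotopy_mapK => k x.
  exact: (bar_comparisonK (A := g) (A' := g') neq neq' hf hh cc).
exact: (bar_comparisonK (A := g') (A' := g) neq' neq hh hf cc).
Qed.
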